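(* Let $R\subset S$ be a minimal finite extension of commutative unital rings. Then the conductor $(R:S)$ is a quasi-maximal ideal of $S$, and it is of the same type (as a quasi-maximal ideal of $S$) as the minimal extension $R\subset S$; that is, $(R:S)$ is inert (resp. decomposed, ramified) as an ideal of $S$ when $R\subset S$ is inert (resp. decomposed, ramified).
   Context: Rings are commutative and unital; $\subset$ is proper inclusion. A proper ideal $I$ of a ring $S$ is quasi-maximal if for every $a\in S\setminus I$, either $I+Sa=S$ or $I+Sa$ is a maximal ideal of $S$. An ideal $I$ of $S$ is inert if it is maximal; decomposed if it is the intersection of two distinct maximal ideals; ramified if there is a maximal ideal $M'$ of $S$ such that $I$ is $M'$-primary, $M'^2\subseteq I\subset M'$ and $M'=I+Sa$ for every $a\in M'\setminus I$. The conductor of $R\subseteq S$ is $(R:S)=\{r\in R\mid rS\subseteq R\}$. An extension $R\subset S$ is minimal if there is no ring strictly between $R$ and $S$; it is finite if $S$ is a finitely generated $R$-module. By a known theorem (Ferrand–Olivier; Dobbs–Picavet–Picavet-L'Hermitte), a minimal finite extension $R\subset S$ satisfies $M:=(R:S)\in\mathrm{Max}(R)$ and is of exactly one of the following types: - inert: $M\in\mathrm{Max}(S)$ and $R/M\to S/M$ is a minimal field extension; - decomposed: there exist $M_1\neq M_2$ in $\mathrm{Max}(S)$ with $M=M_1\cap M_2$ and the natural maps $R/M\to S/M_1$, $R/M\to S/M_2$ are isomorphisms; equivalently, there is $q\in S\setminus R$ with $S=R[q]$, $q^2-q\in M$, $Mq\subseteq M$; - ramified: there is $M'\in\mathrm{Max}(S)$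 with $M'^2\subseteq M\subset M'$, $[S/M:R/M]=2$ and $R/M\to S/M'$ an isomorphism; equivalently, there is $q\in S\setminus R$ with $S=R[q]$, $q^2\in M$, $Mq\subseteq M$. *)

(* Defs.v *)
From HB Require Import structures.
From mathcomp Require Import all_boot all_algebra ring_quotient.
From mathcomp Require Import boolp.

Set Implicit Arguments.
Unset Strict Implicit.
Unset Printing Implicit Defensive.

Import GRing.Theory.
Local Open Scope ring_scope.
Local Open Scope quotient_scope.

(* Subsets of a ring are boolean predicates, compared with =i.  Since         *)
(* `[< P >] reflects an arbitrary proposition P, every subset is of this      *)
(* form, and quantifying over {pred A} is quantifying over all subsets.       *)

Definition proper_subset (T : Type) (P Q : {pred T}) : Prop :=
  {subset P <= Q} /\ exists2 x, x \in Q & x \notin P.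

Section Ideals.
Variable A : comNzRingType.
Implicit Types I J M : {pred A}.

Definition add_principal I (a : A) : {pred A} :=
  [pred x | `[< exists2 i, i \in I & exists s, x = i + s * a >]].

Definition ideal_mul I J : {pred A} :=
  [pred x | `[< exists n (u v : 'I_n -> A),
     [/\ forall k, u k \in I, forall k, v k \in J
       & x = \sum_(k < n) u k * v k] >]].

Definition radical I : {pred A} := [pred x | `[< exists n, x ^+ n \in I >]].

(* The library's idealr_closed includes properness (1 \notin I).              *)
Definition maximal_ideal M : Prop :=
  idealr_closed M /\
  forall J, idealr_closed J -> {subset M <= J} -> J =i M.

Definition primary_ideal I : Prop :=
  idealr_closed I /\
  forall x y, x * y \in I -> x \in I \/ exists n, y ^+ n \in I.

Definition primary_to I M : Prop := primary_ideal I /\ radical I =i M.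

Definition quasi_maximal I : Prop :=
  idealr_closed I /\
  forall a, a \notin I ->
    add_principal I a =i predT \/ maximal_ideal (add_principal I a).

Definition inert_ideal I : Prop := maximal_ideal I.

Definition decomposed_ideal I : Prop :=
  exists M1 M2 : {pred A},
    [/\ maximal_ideal M1, maximal_ideal M2, ~ M1 =i M2
      & I =i [predI M1 & M2]].

Definition ramified_ideal I : Prop :=
  exists M : {pred A},
    [/\ maximal_ideal M, primary_to I M,
        {subset ideal_mul M M <= I}, proper_subset I M
      & forall a, a \in M -> a \notin I -> M =i add_principal I a].

Definition minimal_extension (R : {pred A}) : Prop :=
  [/\ GRing.subring_closed R, exists x, x \notin R
    & forall T : {pred A}, GRing.subring_closed T -> {subset R <= T} ->
        T =i R \/ T =i predT].

Definition finite_extension (R : {pred A}) : Prop :=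
  exists n (g : 'I_n -> A), forall s : A, exists2 c : 'I_n -> A,
    (forall k, c k \in R) & s = \sum_(k < n) c k * g k.

Definition conductor (R : {pred A}) : {pred A} :=
  [pred r | (r \in R) && `[< forall s, r * s \in R >]].

End Ideals.

Definition is_field (A : comNzRingType) : Prop :=
  forall x : A, x != 0 -> exists y, x * y = 1.

Section SubringType.
Variables (S : comNzRingType) (R : subringClosed S).

Record subring_of := SubringOf { subring_val : S; _ : subring_val \in R }.

HB.instance Definition _ := [isSub for subring_val].
HB.instance Definition _ := [Choice of subring_of by <:].
HB.instance Definition _ := [SubChoice_isSubComNzRing of subring_of by <:].

End SubringType.

Section Contraction.
Variables (S : comNzRingType) (R : subringClosed S) (I : idealr S).

Definition contraction : {pred subring_of R} :=
  fun x => \val x \in (I : {pred S}).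

Lemma contraction_idealr_closed : idealr_closed contraction.
Proof.
split; rewrite ?unfold_in /contraction.
- by rewrite rmorph0; exact: idealr0.
- by rewrite rmorph1; apply/negbT; exact: idealr1.
- move=> a u v; rewrite !unfold_in /contraction => uI vI.
  rewrite rmorphD rmorphM; apply: (@rpredD _ I) => //; exact: idealMr.
Qed.

HB.instance Definition _ :=
  isIdealr.Build (subring_of R) contraction contraction_idealr_closed.

End Contraction.

Arguments contraction {S} R I.

Section ResidueMap.
Variables (S : comNzRingType) (R : subringClosed S).
Variables (I : idealr (subring_of R)) (J : idealr S).

(* The natural map R/I -> S/J.  It is independent of the representative, and  *)
(* a ring morphism, when I is contained in J: see the lemmas below.           *)
Definition residue_map (x : {ideal_quot I}) : {ideal_quot J} :=
  \pi_({ideal_quot J}) (\val (repr x)).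

Hypothesis IJ : {subset I <= contraction R J}.

Lemma residue_map_pi (r : subring_of R) :
  residue_map (\pi_({ideal_quot I}) r) = \pi_({ideal_quot J}) (\val r).
Proof.
apply/eqP; rewrite /residue_map -Quotient.idealrBE -rmorphB.
by apply: (IJ (x := _ - _)); rewrite Quotient.idealrBE reprK.
Qed.

Lemma residue_map_zmod_morphism : zmod_morphism residue_map.
Proof.
move=> x y; rewrite -[x]reprK -[y]reprK -rmorphB !residue_map_pi.
by rewrite !rmorphB.
Qed.

Lemma residue_map_monoid_morphism : monoid_morphism residue_map.
Proof.
split=> [|x y]; first by rewrite -(rmorph1 \pi_({ideal_quot I}))
  residue_map_pi !rmorph1.
rewrite -[x]reprK -[y]reprK -rmorphM !residue_map_pi.
by rewrite !rmorphM.
Qed.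

End ResidueMap.

Definition minimal_field_extension (k K : comNzRingType) (f : k -> K) : Prop :=
  [/\ is_field k, is_field K
    & minimal_extension [pred y : K | `[< exists x, f x = y >]]].

(* [K : k] = n, for K a vector space over k through f: there is a basis of    *)
(* n elements.                                                                *)
Definition has_degree (k K : comNzRingType) (f : k -> K) (n : nat) : Prop :=
  exists b : 'I_n -> K, forall y : K,
    exists! c : {ffun 'I_n -> k}, y = \sum_(i < n) f (c i) * b i.

(* In the three types below the conductor is bundled as M : idealr S, which   *)
(* is possible whenever R is not S; contraction R M is M as an ideal of R.    *)
Section ExtensionTypes.
Variables (S : comNzRingType) (R : subringClosed S).

Definition inert_extension : Prop :=
  exists M : idealr S,
    [/\ M =i conductor R, maximal_ideal M
      & minimal_field_extension (@residue_map S R (contraction R M) M)].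

Definition decomposed_extension : Prop :=
  exists M M1 M2 : idealr S,
    [/\ M =i conductor R,
        [/\ maximal_ideal M1, maximal_ideal M2 & ~ M1 =i M2],
        M =i [predI M1 & M2],
        bijective (@residue_map S R (contraction R M) M1)
      & bijective (@residue_map S R (contraction R M) M2)].

Definition ramified_extension : Prop :=
  exists M M' : idealr S,
    [/\ M =i conductor R, maximal_ideal M',
        {subset ideal_mul M' M' <= M} /\ proper_subset M M',
        has_degree (@residue_map S R (contraction R M) M) 2
      & bijective (@residue_map S R (contraction R M) M')].

End ExtensionTypes.

(* Main.v *)
Require Import Defs.
From mathcomp Require Import all_boot all_algebra ring_quotient.
From mathcomp Require Import boolp ring.

(** Write C for the conductor (R : S).  The argument is uniform in the three
    types of extension.  Minimality is applied to the subrings R + J, for J an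
    ideal of S ([minimal_ideal_dichotomy]): either J lies in R, hence in C,
    since C is the largest ideal of S contained in R; or R + J = S.

    Every element x of R outside C is invertible modulo C
    ([conductor_unit_mod]).  The ideal xS is not contained in R, so R + xS = S,
    that is, the finitely generated R-module N = S/R satisfies N = xN.
    Nakayama's lemma gives y in R such that 1 - xy annihilates N, which says
    that 1 - xy lies in C.

    Every proper ideal J of S strictly containing C is maximal
    ([above_conductor_maximal]).  J is not contained in R, so R + J = S.
    Hence an element of S outside J is congruent modulo J to an element of R
    outside J, a fortiori outside C, and such an element is invertible
    modulo C, hence modulo J.  Taking J = C + Sa gives quasi-maximality of C.

    The types are then compared.  An inert or a decomposed extension displays
    C as a maximal ideal, or as an intersection of two.  In the ramified case,
    M' is the only prime ideal containing C because M'^2 is contained in C,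
    so C is M'-primary; and C + Sa, for a in M' outside C, is a proper ideal
    strictly containing C, hence maximal, hence equal to M'. *)

Set Implicit Arguments.
Unset Strict Implicit.
Unset Printing Implicit Defensive.

Import GRing.Theory.
Local Open Scope ring_scope.

(** * Ideals and maximal ideals *)

Section Ideals.
Variable A : comNzRingType.
Implicit Types I J M : {pred A}.

(** Unlike [idealr_closed], this allows the unit ideal: whether an ideal
    I + Aa is proper is usually the point at issue. *)
Definition is_ideal I : Prop :=
  0 \in I /\ forall a, {in I &, forall u v, a * u + v \in I}.

Lemma idealr_closedE I : idealr_closed I <-> is_ideal I /\ 1 \notin I.
Proof. by split=> [[] | [[]]]. Qed.

Lemma idealM I a u : is_ideal I -> u \in I -> a * u \in I.
Proof. by case=> I0 Ilin Iu; rewrite -[_ * _]addr0; apply: Ilin. Qed.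

Lemma idealD I u v : is_ideal I -> u \in I -> v \in I -> u + v \in I.
Proof. by case=> I0 Ilin Iu Iv; rewrite -[u]mul1r; apply: Ilin. Qed.

Lemma idealB I u v : is_ideal I -> u \in I -> v \in I -> u - v \in I.
Proof.
move=> idI Iu Iv; apply: idealD => //.
by rewrite -mulN1r; apply: idealM.
Qed.

Lemma is_ideal_zero : is_ideal (pred1 (0 : A)).
Proof.
split=> [|a u v]; first by rewrite inE.
by rewrite !inE => /eqP-> /eqP->; rewrite mulr0 addr0.
Qed.

Lemma add_principalP I a x :
  reflect (exists2 i, i \in I & exists s, x = i + s * a)
          (x \in add_principal I a).
Proof. by rewrite inE; apply: asboolP. Qed.

Lemma add_principal_ideal I a : is_ideal I -> is_ideal (add_principal I a).
Proof.
move=> idI; split.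
  apply/add_principalP; exists 0; first by case: idI.
  by exists 0; rewrite mul0r addr0.
move=> b u v /add_principalP[i Ii [s ->]] /add_principalP[j Ij [t ->]].
apply/add_principalP; exists (b * i + j); first by case: idI => _; apply.
by exists (b * s + t); ring.
Qed.

Lemma sub_add_principal I a : {subset I <= add_principal I a}.
Proof.
move=> i Ii; apply/add_principalP; exists i => //.
by exists 0; rewrite mul0r addr0.
Qed.

Lemma mem_add_principal I a : is_ideal I -> a \in add_principal I a.
Proof.
case=> I0 _; apply/add_principalP; exists 0 => //.
by exists 1; rewrite mul1r add0r.
Qed.

Lemma maximal_ideal_closed M : maximal_ideal M -> is_ideal M.
Proof. by case=> /idealr_closedE[]. Qed.

Lemma maximal_unit_mod M x :
  maximal_ideal M -> x \notin M -> exists s, 1 - s * x \in M.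
Proof.
move=> maxM /negP xM; have idM := maximal_ideal_closed maxM.
have [/add_principalP[i Mi [s def1]] | J1] := boolP (1 \in add_principal M x).
  by exists s; rewrite def1 addrK.
have idJ: idealr_closed (add_principal M x).
  by apply/idealr_closedE; split=> //; exact: add_principal_ideal.
case: xM; rewrite -(maxM.2 _ idJ (@sub_add_principal M x)).
exact: mem_add_principal.
Qed.

Lemma unit_mod_maximal M :
    is_ideal M -> 1 \notin M ->
    (forall x, x \notin M -> exists s, 1 - s * x \in M) ->
  maximal_ideal M.
Proof.
move=> idM M1 unitM; split=> [|J /idealr_closedE[idJ J1] MJ x].
  exact/idealr_closedE.
apply/idP/idP=> [Jx | /MJ//]; apply/negPn/negP=> /unitM[s Ms].
case/negP: J1; rewrite -(subrK (s * x) 1).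
by apply: (idealD idJ (MJ _ Ms)); apply: idealM.
Qed.

Lemma maximal_ideal_eq I J : I =i J -> maximal_ideal I -> maximal_ideal J.
Proof.
move=> eqIJ maxI; have [/idealr_closedE[[I0 Ilin] I1] _] := maxI.
apply: unit_mod_maximal; rewrite -?eqIJ //.
- by split=> [|a u v]; rewrite -!eqIJ //; apply: Ilin.
- move=> x; rewrite -eqIJ => /(maximal_unit_mod maxI)[s].
  by exists s; rewrite -eqIJ.
Qed.

Lemma maximal_ideal_exp M x n : maximal_ideal M -> x ^+ n \in M -> x \in M.
Proof.
move=> maxM; have idM := maximal_ideal_closed maxM.
have [/idealr_closedE[_ M1] _] := maxM.
move=> Mxn; apply/negPn/negP=> /(maximal_unit_mod maxM)[s Ms].
elim: n Mxn => [|n IHn] Mxn; first by rewrite expr0 (negPf M1) in Mxn.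
apply: IHn; have -> : x ^+ n = x ^+ n * (1 - s * x) + s * x ^+ n.+1.
  by rewrite exprS; ring.
by apply: idealD => //; apply: idealM.
Qed.

(** An ideal between M^2 and M has radical M, and is primary: modulo such an
    ideal every element of M squares to zero, and every element y outside M is
    a unit, since 1 - sy in M gives (1 - sy)^2 in I. *)
Lemma primary_between_square I M :
    is_ideal I -> maximal_ideal M -> {subset I <= M} ->
    {in M &, forall u v, u * v \in I} ->
  primary_to I M.
Proof.
move=> idI maxM IM MMI; have [/idealr_closedE[idM M1] _] := maxM.
split; last first.
  move=> x; rewrite inE; apply/asboolP/idP=> [[n /IM]|Mx].
    exact: maximal_ideal_exp.
  by exists 2; rewrite expr2 MMI.
split=> [|x y Ixy].
  by apply/idealr_closedE; split=> //; apply: contra M1 => /IM.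
have [My | /(maximal_unit_mod maxM)[s Ms]] := boolP (y \in M).
  by right; exists 2; rewrite expr2 MMI.
left; have -> : x = x * ((1 - s * y) * (1 - s * y)) + s * (2 - s * y) * (x * y).
  by ring.
by apply: (idealD idI); apply: (idealM _ idI) => //; apply: MMI.
Qed.

End Ideals.

(** * Nakayama's lemma for the module S/R *)

Section Nakayama.
Variables (S : comNzRingType) (R : subringClosed S).

(** The first quantified hypothesis says that x(S/R) = S/R.  The generators are
    eliminated one at a time, keeping a multiplier u = 1 - xy that carries S/R
    into the span of those that remain; y = 0 is the case where the g k span
    S/R itself.  Since u g_n lies in xu(S/R), it is x times a combination of
    g_0, ..., g_n; when its last term xc g_n is moved to the left, u - xc is
    seen to carry g_n into the span of the others. *)
Lemma quotient_nakayama n (g : 'I_n -> S) (x y : S) :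
    x \in R -> y \in R ->
    (forall s, exists2 t, t \in R & exists z, s = t + z * x) ->
    (forall s, exists2 c : 'I_n -> S, forall k, c k \in R
       & (1 - x * y) * s - \sum_(k < n) c k * g k \in R) ->
  exists2 z, z \in R & forall s, (1 - x * z) * s \in R.
Proof.
move=> Rx + RxS; elim: n g y => [|n IHn] g y Ry spanS.
  by exists y => // s; have [c _] := spanS s; rewrite big_ord0 subr0.
have [r Rr [t def_gn]] := RxS (g ord_max).
have [c Rc] := spanS t; rewrite big_ord_recr /=.
set C := \sum_(k < n) _ => Rt.
pose w := widen_ord (leqnSn n).
have Ru : 1 - x * y \in R by rewrite rpredB ?rpred1 ?rpredM.
have Ryc : y + c ord_max \in R by rewrite rpredD.
(* y' is chosen so that 1 - x y' = (1 - x (y + c_n)) (1 - x y): the second    *)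
(* factor carries S/R into the span of g_0, ..., g_n, and the first carries   *)
(* g_n into the span of the others.                                           *)
pose y' := y + (y + c ord_max) * (1 - x * y).
have Ry' : y' \in R by rewrite /y' rpredD // rpredM.
apply: (IHn (fun k => g (w k)) y') => // s.
have [d Rd] := spanS s; rewrite big_ord_recr /=.
set D := \sum_(k < n) _ => Rs.
pose v := 1 - x * (y + c ord_max).
have Rv : v \in R by rewrite /v rpredB ?rpred1 ?rpredM.
exists (fun k => v * d (w k) + d ord_max * x * c (w k)) => [k|].
  by rewrite rpredD ?rpredM // rpredM.
have -> : \sum_(k < n) (v * d (w k) + d ord_max * x * c (w k)) * g (w k)
          = v * D + d ord_max * x * C.
  rewrite /D /C !mulr_sumr -big_split /=; apply: eq_bigr => k _.
  by rewrite mulrDl !mulrA.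
have -> : (1 - x * y') * s - (v * D + d ord_max * x * C)
  = v * ((1 - x * y) * s - (D + d ord_max * g ord_max))
    + d ord_max * (x * ((1 - x * y) * t - (C + c ord_max * g ord_max))
                   + (1 - x * y) * r).
  (* The two sides differ by a multiple of g_n - (r + t x), which vanishes.  *)
  apply/eqP; rewrite -subr_eq0; apply/eqP.
  have E : g ord_max - (r + t * x) = 0 by rewrite -def_gn subrr.
  rewrite -[RHS](mulr0 (d ord_max * (1 - x * y))) -E /v /y'; ring.
by rewrite rpredD ?rpredM // rpredD ?rpredM.
Qed.

End Nakayama.

(** * The conductor of a minimal finite extension *)

Section Conductor.
Variables (S : comNzRingType) (R : subringClosed S).

Lemma conductorP r :
  reflect (r \in R /\ forall s, r * s \in R) (r \in conductor R).
Proof.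
rewrite inE; apply: (iffP andP) => [[Rr /asboolP] | [Rr RrS]] //.
by split=> //; apply/asboolP.
Qed.

Lemma conductor_ideal : is_ideal (conductor R).
Proof.
split; first by apply/conductorP; split=> [|s]; rewrite ?mul0r rpred0.
move=> a u v /conductorP[Ru RuS] /conductorP[Rv RvS]; apply/conductorP.
split=> [|s]; first by rewrite rpredD // mulrC.
have -> : (a * u + v) * s = u * (a * s) + v * s by ring.
by rewrite rpredD.
Qed.

Lemma ideal_sub_conductor (J : {pred S}) :
  is_ideal J -> {subset J <= R} -> {subset J <= conductor R}.
Proof.
move=> idJ JR j Jj; apply/conductorP; split=> [|s]; first exact: JR.
by rewrite mulrC JR ?idealM.
Qed.

Hypothesis minR : minimal_extension R.

Lemma conductor1 : 1 \notin conductor R.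
Proof.
case: minR => _ [s Rs] _; apply/negP=> /conductorP[_ /(_ s)].
by rewrite mul1r (negPf Rs).
Qed.

Lemma minimal_ideal_dichotomy (J : {pred S}) :
  is_ideal J ->
  {subset J <= conductor R} \/ forall s, exists2 r, r \in R & s - r \in J.
Proof.
move=> idJ; have [J0 Jlin] := idJ.
pose T : {pred S} := [pred s | `[< exists2 r, r \in R & s - r \in J >]].
have TP s : reflect (exists2 r, r \in R & s - r \in J) (s \in T).
  by rewrite inE; apply: asboolP.
have RT : {subset R <= T} by move=> r Rr; apply/TP; exists r; rewrite ?subrr.
have ringT : GRing.subring_closed T.
  split=> [|s t /TP[r Rr Js] /TP[q Rq Jt] |s t /TP[r Rr Js] /TP[q Rq Jt]].
  - by rewrite RT ?rpred1.
  - apply/TP; exists (r - q); first exact: rpredB.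
    have -> : s - t - (r - q) = (s - r) - (t - q) by ring.
    exact: idealB.
  - apply/TP; exists (r * q); first exact: rpredM.
    have -> : s * t - r * q = t * (s - r) + r * (t - q) by ring.
    by apply: Jlin => //; apply: idealM.
case: minR => _ _ /(_ T ringT RT)[eqTR | eqTS]; [left | right] => [|s].
  apply: ideal_sub_conductor => // j Jj; rewrite -eqTR; apply/TP.
  by exists 0; rewrite ?rpred0 ?subr0.
by apply/TP; rewrite eqTS.
Qed.

Hypothesis finR : finite_extension R.

Lemma conductor_unit_mod x :
  x \in R -> x \notin conductor R -> exists y, 1 - y * x \in conductor R.
Proof.
move=> Rx Cx; have idxS := add_principal_ideal x (is_ideal_zero S).
case: (minimal_ideal_dichotomy idxS) => [xSC | RxS].
  by rewrite xSC ?mem_add_principal in Cx => //; apply: is_ideal_zero.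
have [n [g spanS]] := finR.
have [||s|s|y Ry ann] := @quotient_nakayama S R n g x 0; rewrite ?rpred0 //.
- have [r Rr /add_principalP[i]] := RxS s.
  rewrite inE => /eqP-> [z def_s]; exists r => //; exists z.
  by rewrite -[s](subrK r) def_s add0r addrC.
- have [c Rc def_s] := spanS s; exists c => //.
  by rewrite mulr0 subr0 mul1r -def_s subrr rpred0.
exists y; rewrite mulrC; apply/conductorP; split=> //.
by rewrite -[_ - _]mulr1.
Qed.

Lemma above_conductor_maximal (J : {pred S}) :
    is_ideal J -> 1 \notin J -> {subset conductor R <= J} ->
    ~ {subset J <= conductor R} ->
  maximal_ideal J.
Proof.
move=> idJ J1 CJ nJC.
case: (minimal_ideal_dichotomy idJ) => // RJ.
apply: unit_mod_maximal => // s Js.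
have [r Rr Jsr] := RJ s.
have Cr : r \notin conductor R.
  apply: contra Js => /CJ Jr; rewrite -(subrK r s); exact: idealD.
have [y Cy] := conductor_unit_mod Rr Cr; exists y.
have -> : 1 - y * s = (1 - y * r) - y * (s - r) by ring.
by apply: (idealB idJ (CJ _ Cy)); apply: idealM.
Qed.

Lemma conductor_quasi_maximal : quasi_maximal (conductor R).
Proof.
have idC := conductor_ideal; split=> [|a Ca].
  by apply/idealr_closedE; split=> //; apply: conductor1.
have idJ := add_principal_ideal a idC.
have [J1 | J1] := boolP (1 \in add_principal (conductor R) a); [left | right].
  by move=> s; rewrite -[s]mulr1 idealM.
apply: above_conductor_maximal => //; first exact: sub_add_principal.
by move/(_ a (mem_add_principal a idC)); rewrite (negPf Ca).
Qed.

Lemma conductor_ramified (M : {pred S}) :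
    maximal_ideal M -> proper_subset (conductor R) M ->
    {subset ideal_mul M M <= conductor R} ->
  ramified_ideal (conductor R).
Proof.
move=> maxM CM MMC; have idC := conductor_ideal.
have [/idealr_closedE[idM M1] _] := maxM.
exists M; split=> //.
  apply: primary_between_square => //; first by case: CM.
  move=> u v Mu Mv; apply: MMC; rewrite inE; apply/asboolP.
  by exists 1, (fun=> u), (fun=> v); split=> //; rewrite big_ord1.
move=> a Ma Ca.
have JM : {subset add_principal (conductor R) a <= M}.
  move=> x /add_principalP[i Ci [s ->]].
  by apply: (idealD idM (CM.1 _ Ci)); apply: idealM.
have [_ /(_ a Ca)[JS | maxJ]] := conductor_quasi_maximal.
  by case/negP: M1; apply: JM; rewrite JS.
by apply: maxJ.2 JM; case: maxM.
Qed.

End Conductor.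

Theorem theorem4p1 (S : comNzRingType) (R : subringClosed S) :
  minimal_extension R -> finite_extension R ->
  [/\ quasi_maximal (conductor R),
      inert_extension R -> inert_ideal (conductor R),
      decomposed_extension R -> decomposed_ideal (conductor R)
    & ramified_extension R -> ramified_ideal (conductor R)].
Proof.
move=> minR finR; split; first exact: conductor_quasi_maximal.
- by case=> M [eqMC maxM _]; apply: maximal_ideal_eq eqMC maxM.
- case=> M [M1 [M2 [eqMC [max1 max2 neq12] eqM _ _]]].
  by exists (M1 : {pred S}), (M2 : {pred S}); split=> // x; rewrite -eqMC eqM.
- case=> M [M' [eqMC maxM' [MM' [subM [x M'x Mx]]] _ _]].
  apply: (@conductor_ramified S R minR finR M') => //.
    split=> [y|]; first by rewrite -eqMC => /subM.
    by exists x; rewrite // -eqMC.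
  by move=> y /MM'; rewrite eqMC.
Qed.
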